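(* Let $p$ be a prime and let $(r,e,d)$ be integers such that both $(r,e,d)$ and $(r,e+1,d)$ lie in $\mathscr{B}_0(p)$ (so $d=r-1$), and put $n=p-1-e$. Then the entries of the matrices $B_r,Q_r,Z_{r,n},P_r$ (defined over $\mathbb{Q}$ below) can be reduced modulo $p$, $M_d(f(x)^e)$ is invertible, and, with these reductions, \[ M_d(f(x)^e)^{-1}\,M_d(f(x)^{e+1})=B_r\,Q_r\,Z_{r,n}\,P_r . \]
   Context: $\mathscr{B}_0(p)$ is the set of integer triples $(r,e,d)$ with $2\le r\le p+1$, $(p-1)/2<e\le p-1$, $r(p-1-e)\le p-1$, $d=r-1$. Let $f(x)=x^r+s_1x^{r-1}+\cdots+s_r=(x-x_1)\cdots(x-x_r)$ with $x_1,\dots,x_r$ independent indeterminates; over $\mathbb{F}_p$, for an integer $k\ge0$ write $f(x)^k=\sum_i c^{(k)}_ix^i$ ($c^{(k)}_i=0$ for $i<0$) and let $M_d(f(x)^k)$ be the $d\times d$ matrix with $(i,j)$ entry $c^{(k)}_{ip+j-d-1}$. The following matrices are defined with $x_1,\dots,x_r$ independent over $\mathbb{Q}$ (entries in $\mathbb{Q}[s_1,\dots,s_r]$). Let $\varphi(t)=1+s_1t+\cdots+s_rt^r$ and for $\lambda\in\mathbb{C}$, $\ell\in\mathbb{Z}$ let $\beta_\ell(\lambda)$ be the coefficient of $t^\ell$ in $\varphi(t)^\lambda$ (so $\beta_0=1$, $\beta_\ell=0$ for $\ell<0$). For polynomials $F,G$ with $D=\max(\deg F,\deg G)$, the Bézout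 matrix $\mathrm{Bez}(F,G)$ is the $D\times D$ matrix with $\frac{F(x)G(y)-F(y)G(x)}{x-y}=(1,x,\ldots,x^{D-1})\,\mathrm{Bez}(F,G)\,(1,y,\ldots,y^{D-1})^T$. Let $J$ be the $(r-1)\times(r-1)$ matrix with ones on the antidiagonal and zeros elsewhere. Define $(r-1)\times(r-1)$ matrices: $B_r=J\,\mathrm{Bez}\bigl(f'(x),\,f(x)-\tfrac1r xf'(x)\bigr)$; $Q_r$ with $(i,j)$ entry $\beta_{i-j}(-j/r)$; $Z_{r,n}=\mathrm{diag}(\zeta_1,\ldots,\zeta_{r-1})$ with $\zeta_i=\frac{n}{rn-(r-i)}$; $P_r$ with $(i,j)$ entry $\beta_{i-j}(-(r-i)/r)$. *)

(* Defs.v *)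
From HB Require Import structures.
From mathcomp Require Import all_boot all_order all_algebra.
From mathcomp Require Import mpoly.
Set Implicit Arguments. Unset Strict Implicit. Unset Printing Implicit Defensive.
Import Order.TTheory GRing.Theory Num.Theory.
Local Open Scope ring_scope.

Definition fpoly (R : comNzRingType) (r : nat) : {poly {mpoly R[r]}} :=
  \prod_(i < r) ('X - ('X_i)%:P).

Definition coefz (A : nzRingType) (P : {poly A}) (m : int) : A :=
  if (m < 0)%R then 0 else P`_(`|m|%N).

(* M_d(g): (i,j) entry (1-indexed) c_{ip+j-d-1}; here i, j : 'I_d are 0-indexed *)
Definition Mmx (A : nzRingType) (p d : nat) (g : {poly A}) : 'M[A]_d :=
  \matrix_(i < d, j < d)
    coefz g ((i.+1 * p + j.+1)%N%:Z - d%:Z - 1).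

(* Bezout matrix of size D: (F(x)G(y) - F(y)G(x))/(x-y) = sum_{i,j} Bez_{ij} x^i y^j
   (0-indexed); x is the outer variable, y the inner one of {poly {poly A}}. *)
Definition bezout_mx (A : idomainType) (D : nat) (F G : {poly A}) : 'M[A]_D :=
  let N := map_poly polyC F * (G%:P) - F%:P * map_poly polyC G in
  let Q := N %/ ('X - ('X)%:P) in
  \matrix_(i < D, j < D) (Q`_i)`_j.

Definition Jmx (A : nzRingType) (D : nat) : 'M[A]_D :=
  \matrix_(i < D, j < D) (((i + j)%N == D.-1)%:R).

Section RationalMatrices.
Variables (r d : nat).
Local Notation A := {mpoly rat[r]}.
Local Notation f := (fpoly rat r).

Definition scoef (k : nat) : A := f`_(r - k).

Definition phi : {poly A} := \poly_(k < r.+1) scoef k.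

Definition binr (lam : rat) (k : nat) : rat :=
  (\prod_(i < k) (lam - i%:R)) / (k`!)%:R.

(* beta_l(lambda): coefficient of t^l in phi(t)^lambda = sum_k binom(lambda,k) (phi(t)-1)^k *)
Definition beta (lam : rat) (l : int) : A :=
  if (l < 0)%R then 0
  else \sum_(k < `|l|%N.+1) (binr lam k)%:MP * ((phi - 1) ^+ k)`_(`|l|%N).

Definition Bmx : 'M[A]_d :=
  Jmx A d *m bezout_mx d f^`() (f - ((((r%:R : rat)^-1)%:MP)%:P * ('X * f^`()))).

Definition Qmx : 'M[A]_d :=
  \matrix_(i < d, j < d) beta (- (j.+1%:R) / r%:R) (i%:Z - j%:Z).

Definition Zmx (n : nat) : 'M[A]_d :=
  \matrix_(i < d, j < d)
    (if i == j then ((n%:R / (r%:R * n%:R - (r%:R - i.+1%:R))) : rat)%:MP else 0).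

Definition Pmx : 'M[A]_d :=
  \matrix_(i < d, j < d) beta (- (r%:R - i.+1%:R) / r%:R) (i%:Z - j%:Z).

End RationalMatrices.

Definition pint (p : nat) (q : rat) : bool := ~~ (p %| `|denq q|)%N.

Definition mx_pint (p r d : nat) (M : 'M[{mpoly rat[r]}]_d) : Prop :=
  forall (i j : 'I_d) (m : 'X_{1..r}), pint p ((M i j)@_m).

Definition redp (p : nat) (q : rat) : 'F_p := (numq q)%:~R / (denq q)%:~R.

Definition redmx (p r d : nat) (M : 'M[{mpoly rat[r]}]_d) : 'M[{mpoly 'F_p[r]}]_d :=
  map_mx (map_mpoly (redp p)) M.

Definition inB0 (p r e d : nat) : Prop :=
  [/\ (2 <= r <= p.+1)%N, (p.-1 < 2 * e)%N, (e <= p.-1)%N,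
      (r * (p.-1 - e) <= p.-1)%N & d = r.-1].

(* Main.v *)
(** Write [u = f^(1/r)], a local parameter at infinity up to inversion.  Modulo
    [p] one has [f^e = f^p / f^(n+1)] and [f^(e+1) = f^p / f^n], and the entries
    of the matrices [M_d] are the coefficients of [x^(ip)] in [x^(r-j) f^e] and
    [x^(r-j) f^(e+1)].  These coefficients vanish on derivatives
    [x (d/dx)(h f^(e+1))], so the quotient of the two matrices is the pole
    reduction [x^(r-j) f^(-n) = sum_k N_kj x^(r-k) f^(-n-1)] modulo exact forms.

    The reduction factors: [P] expands [x^(r-j) dx/x] along the forms
    [u^(r-i) du/u], which diagonalise it (whence [Z], as
    [u^(r-i-rn) du/u] is exact), and the polynomial parts of the powers of [u]
    are brought back to the monomial basis by residues of the Bezout kernel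
    against [u^(-i) = sum_l Q_li x^(-l)].

    For the invertibility of [M_d(f^e)] specialise [f] to [x^r + 1]: as [r] is
    prime to [p], the matrix becomes monomial with binomial coefficients
    [binom(e, q)], [q <= e < p], as nonzero entries. *)
Require Import Defs.
From HB Require Import structures.
From mathcomp Require Import all_boot all_order all_algebra all_field.
From mathcomp Require Import mpoly.
From mathcomp Require Import zify ring.
Set Implicit Arguments. Unset Strict Implicit. Unset Printing Implicit Defensive.
Import GRing.Theory.
Local Open Scope ring_scope.

(** * Coefficients of the Bezout matrix *)

Section Bezout.
Variables (A : idomainType) (F G : {poly A}).

(** Closed form for the coefficient of [x^a y^b] in the Bezout kernel: division by [x - y]
    telescopes along the antidiagonal of total degree [a + b + 1]. *)
Definition bez_coef (a b : nat) : A :=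
  \sum_(c < a.+1) (F`_(a + b - c).+1 * G`_c - F`_c * G`_(a + b - c).+1).

Let N : {poly {poly A}} := map_poly polyC F * G%:P - F%:P * map_poly polyC G.

(** Setting [x = y] kills the numerator; as [x - y] is monic in [x], the division is then exact. *)
Lemma bezout_quotient : N = N %/ ('X - ('X)%:P) * ('X - ('X)%:P).
Proof.
have /factor_theorem[q Dq]: root N 'X.
  rewrite /root /N hornerD hornerN !hornerM !hornerC.
  have E (P : {poly A}) : (map_poly polyC P).['X] = P.
    by rewrite -/(comp_poly 'X P) comp_polyXr.
  by rewrite !E subrr.
by rewrite Dq Pdiv.IdomainMonic.mulpK ?monicXsubC.
Qed.

(** Comparing coefficients in [N = Q (x - y)] gives [Q_(c,k) = Q_(c-1,k+1) - N_(c,k+1)], which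
    unrolls by induction on [a]. *)
Lemma coef_bezout_quotient a b : (N %/ ('X - ('X)%:P))`_a`_b = bez_coef a b.
Proof.
have DN c k : N`_c`_k = F`_c * G`_k - F`_k * G`_c.
  rewrite /N coefB coefMC coefCM !coef_map /= coefB coefCM coefMC.
  by [].
set Q := N %/ _.
have rec c k : N`_c`_k.+1 = (if c is c'.+1 then Q`_c'`_k.+1 else 0) - Q`_c`_k.
  rewrite bezout_quotient -/Q mulrBr coefB coefB coefMX coefMC coefMX.
  by case: c => [|c] //=; rewrite coef0.
have {}rec c k : Q`_c`_k = (if c is c'.+1 then Q`_c'`_k.+1 else 0)
       + (F`_k.+1 * G`_c - F`_c * G`_k.+1).
  have := rec c k; rewrite DN; set t := (if _ is _.+1 then _ else _) => E.
  by rewrite -[LHS](subKr t) -E; ring.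
elim: a b => [|a IH] b; rewrite /bez_coef rec.
  by rewrite big_ord1 add0r subn0 add0n.
rewrite IH big_ord_recr /= addKn; congr (_ + _).
by apply: eq_bigr => c _; rewrite addSnnS.
Qed.

Lemma bezout_mxE D (a b : 'I_D) : bezout_mx D F G a b = bez_coef a b.
Proof. by rewrite mxE coef_bezout_quotient. Qed.

(** The numerator has size at most [D] in [x], and division by a monic linear factor lowers the size
    by one. *)
Lemma bez_coef_eq0 D a b : (size F <= D)%N -> (size G <= D)%N -> (D.-1 <= a)%N ->
  bez_coef a b = 0.
Proof.
move=> sF sG Da; rewrite -coef_bezout_quotient; set Q := N %/ _.
suff sQ : (size Q <= a)%N by rewrite (nth_default 0 sQ) coef0.
have [->|Q0] := eqVneq Q 0; first by rewrite size_poly0.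
have sN : (size N <= D)%N.
  apply/leq_sizeP => j Dj; apply/polyP => k.
  rewrite /N coefB coefMC coefCM !coef_map /= coefB coefCM coefMC coef0.
  by rewrite (nth_default _ (leq_trans sF Dj)) (nth_default _ (leq_trans sG Dj)) mul0r mulr0 subrr.
move: sN; rewrite bezout_quotient -/Q size_Mmonic ?monicXsubC // size_XsubC.
rewrite addn2 /= => sN; apply: leq_trans Da; rewrite -ltnS; apply: leq_trans sN (leqSpred _).
Qed.
End Bezout.

(** * The binomial series of phi *)

Lemma binr_rec (lam : rat) k :
  binr lam k.+1 * k.+1%:R = binr lam k * (lam - k%:R).
Proof.
rewrite /binr big_ord_recr /= factS natrM invfM.
have : (k`!)%:R != 0 :> rat by rewrite Num.Theory.pnatr_eq0 -lt0n fact_gt0.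
have : (k.+1)%:R != 0 :> rat by rewrite Num.Theory.pnatr_eq0.
move: (\prod_(i < k) _) (k`!%:R) (k.+1%:R) => P F K hK hF.
by field; rewrite hF hK.
Qed.

(** Truncating [(1 + psi)^lam] leaves a single error term in its differential equation, at order
    [N]; the recurrence on [b] moves it up one order at each induction step. *)
Lemma binomial_series_ode (A : comNzRingType) (b : nat -> A) (lam : A)
    (psi : {poly A}) N :
  (forall k, b k.+1 * k.+1%:R = b k * (lam - k%:R)) ->
  let S := \sum_(k < N.+1) (b k)%:P * psi ^+ k in
  (1 + psi) * S^`() = lam%:P * psi^`() * S
    - (b N.+1 * N.+1%:R)%:P * psi^`() * psi ^+ N.
Proof.
move=> rec /=; elim: N => [|N IH].
  rewrite big_ord1 expr0 derivM derivC mul0r add0r (rec 0%N) subr0 polyCM.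
  by rewrite -[1]polyC1 derivC; ring.
rewrite big_ord_recr /= derivD mulrDr IH derivM derivC mul0r add0r deriv_exp.
rewrite [X in _ = _ - X%:P * _ * _]rec !polyCM polyCB !polyC_natr /= exprS.
move: (\sum_(i < N.+1) _) => S; rewrite -[_ *+ N.+1]mulr_natl; ring.
Qed.

Section Binomial.
Variables (r : nat).
Local Notation A := {mpoly rat[r]}.
Local Notation f := (fpoly rat r).
Local Notation phi := (phi r).

(** A polynomial stand-in for the series [phi^lam]: as [t] divides [phi - 1], the coefficients up to
    degree [N] are exact. *)
Definition binpow (N : nat) (lam : rat) : {poly A} :=
  \sum_(k < N.+1) ((binr lam k)%:MP)%:P * (phi - 1) ^+ k.

Lemma size_fpoly : size f = r.+1.
Proof. by rewrite /fpoly size_prod_XsubC /index_enum -enumT size_enum_ord. Qed.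

Lemma fpoly_lead : f`_r = 1.
Proof.
have /monicP := monic_prod_XsubC (index_enum 'I_r) xpredT (fun i => 'X_i : A).
by rewrite lead_coefE -/(fpoly rat r) size_fpoly.
Qed.

Lemma phi0 : phi`_0 = 1.
Proof. by rewrite coef_poly /= /scoef subn0 fpoly_lead. Qed.

Lemma coef_phi k : (k <= r)%N -> phi`_k = f`_(r - k).
Proof. by move=> kr; rewrite coef_poly ltnS kr. Qed.

Lemma phiB1 : exists psi, phi - 1 = 'X * psi.
Proof.
have /factor_theorem[q ->]: root (phi - 1) 0.
  by rewrite /root horner_coef0 coefB phi0 coef1 subrr.
by exists q; rewrite subr0 mulrC.
Qed.

Lemma coef_phiB1_exp k l : (l < k)%N -> ((phi - 1) ^+ k)`_l = 0.
Proof.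
by move=> lk; have [psi ->] := phiB1; rewrite exprMn coefXnM lk.
Qed.

Lemma beta_neg lam l : (l < 0)%R -> beta r lam l = 0.
Proof. by rewrite /beta => ->. Qed.

Lemma coef_binpow N lam l : (l <= N)%N -> (binpow N lam)`_l = beta r lam l%:Z.
Proof.
move=> lN; rewrite /beta /= coef_sum.
rewrite -(big_mkord xpredT (fun k => (((binr lam k)%:MP)%:P * (phi - 1) ^+ k)`_l)).
rewrite (big_cat_nat (leq0n l.+1)) //= [X in _ + X]big1_seq ?addr0.
  by rewrite big_mkord; apply: eq_bigr => k _; rewrite coefCM.
move=> k; rewrite mem_index_iota => /andP[_ /andP[lk _]].
by rewrite coefCM coef_phiB1_exp ?mulr0.
Qed.

Lemma mpolyC_binr_rec lam k :
  (binr lam k.+1)%:MP * k.+1%:R = (binr lam k)%:MP * (lam%:MP - k%:R) :> A.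
Proof.
rewrite -(rmorph_nat (@mpolyC r rat)) -(rmorph_nat (@mpolyC r rat) k).
by rewrite -rmorphB -!rmorphM /= binr_rec.
Qed.

Lemma binpow_ode N lam :
  phi * (binpow N lam)^`() = (lam%:MP)%:P * phi^`() * binpow N lam
    - ((binr lam N.+1)%:MP * N.+1%:R)%:P * phi^`() * (phi - 1) ^+ N.
Proof.
have := binomial_series_ode (phi - 1) N (mpolyC_binr_rec lam).
have -> : 1 + (phi - 1) = phi by rewrite addrCA subrr addr0.
have -> : (phi - 1)^`() = phi^`() by rewrite derivB -polyC1 derivC subr0.
by [].
Qed.
End Binomial.

(** * Fractional powers of f at infinity *)

Section RootPowers.
Variables (A : comNzRingType) (r : nat) (phi : {poly A}).
Hypothesis phi_0 : phi`_0 = 1.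

(** The Euler operator, applied in [t] to [phi] and [V], and in [x] to [f] and the polar parts. *)
Definition theta (P : {poly A}) : {poly A} := 'X * P^`().

Lemma coef_theta P l : (theta P)`_l = l%:R * P`_l.
Proof.
by case: l => [|l]; rewrite coefXM /= ?mul0r // coef_deriv mulr_natl.
Qed.

Lemma thetaM P Q : theta (P * Q) = theta P * Q + P * theta Q.
Proof. by rewrite /theta derivM; ring. Qed.

(* In the variable [t = 1/x], [V] satisfies modulo [t^(r+1)] the differential
   equation of [f^(-i/r) = t^i phi(t)^(-i/r)]. *)
Definition root_ode (i : nat) (V : {poly A}) := exists D,
  r%:R * phi * theta V = i%:R * (r%:R * phi - theta phi) * V + 'X^(r.+1) * D.

(** [phi] has constant term 1, hence is a unit modulo [t^(r+1)]. *)
Lemma phi_cancel P :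
  (forall l, (l <= r)%N -> (phi * P)`_l = 0) -> forall l, (l <= r)%N -> P`_l = 0.
Proof.
move=> H l; elim/ltn_ind: l => l IH lr.
have := H _ lr; rewrite coefM big_ord_recl phi_0 mul1r subn0 big1 ?addr0 // => k _.
by rewrite IH ?mulr0 //= /bump; have := ltn_ord k; lia.
Qed.

(** For [V = t^i phi^(-i/r)] this is the differential equation of [phi V = t^i phi^(1-i/r)], cleared
    of the denominator [r]. *)
Lemma root_ode_phiM i V : (i <= r)%N -> root_ode i V -> exists D,
  r%:R * theta (phi * V)
  = (i * r)%:R * (phi * V) + (r - i)%:R * (theta phi * V) + 'X^(r.+1) * D.
Proof.
move=> ir [D E]; exists D; rewrite thetaM natrB // natrM.
by rewrite mulrDr [r%:R * (phi * _)]mulrA E; ring.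
Qed.

Lemma coef_root_phiM i V l : (i <= r)%N -> root_ode i V -> (l <= r)%N ->
  l%:R * r%:R * (phi * V)`_l
  = (i * r)%:R * (phi * V)`_l + (r - i)%:R * (theta phi * V)`_l.
Proof.
move=> ir ode lr; have [D /(congr1 (fun P : {poly A} => P`_l))] := root_ode_phiM ir ode.
rewrite !coefD coefXnM ltnS lr addr0.
by rewrite -!polyC_natr !coefCM coef_theta => <-; ring.
Qed.

(* The residue of [u^(-m) d(u^m')] vanishes for [m <> m']. *)
Lemma coef_root_ortho m m' V V' : (m' <= r)%N ->
  root_ode m V -> root_ode (r - m') V' ->
  r%:R * (m'%:R - m%:R) * (theta V * (phi * V'))`_r = 0.
Proof.
move=> m'r [D E] /(root_ode_phiM (leq_subr _ _))[D' E'].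
set W := phi * V' in E' *.
have Dr : r%:R = (r - m')%:R + m'%:R :> {poly A} by rewrite -natrD subnK.
(* The [theta phi] terms of the two differential equations cancel in this combination, so [phi * Z]
   vanishes modulo [t^(r+1)]. *)
pose Z := r%:R * (m'%:R * (theta V * W) + m%:R * (V * theta W)
                  - (m * r)%:R * (V * W)).
have : Z`_r = 0.
  apply: phi_cancel (leqnn r) => l lr.
  have -> : phi * Z = 'X^(r.+1) * (m'%:R * D * W + m%:R * phi * V * D').
    rewrite /Z subKn // in E' *.
    transitivity (m'%:R * W * (r%:R * phi * theta V)
        + m%:R * phi * V * (r%:R * theta W) - r%:R * (m * r)%:R * phi * (V * W)).
      by ring.
    rewrite E E' /W !natrM natrB //; ring.
  by rewrite coefXnM ltnS lr.
(* The Leibniz rule at degree [r] eliminates both [V W] and [V theta W] from [Z_r = 0]. *)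
have : r%:R * (V * W)`_r = (theta V * W)`_r + (V * theta W)`_r.
  by rewrite -coef_theta thetaM coefD.
rewrite /Z -!polyC_natr !(coefCM, coefB, coefD) natrM.
move: (theta V * W)`_r (V * theta W)`_r (V * W)`_r => a b c E1 E2.
have Eb : b = r%:R * c - a by rewrite E1; ring.
by rewrite -[RHS]E2 Eb; ring.
Qed.

End RootPowers.

(** * The Bezout kernel against fractional powers of [f] *)

Section BezoutRoot.
Variables (A : idomainType) (r : nat) (phi f : {poly A}) (rho : A).
Hypothesis rhoK : rho * r%:R = 1.
Hypothesis size_f : (size f <= r.+1)%N.
Hypothesis phi_f : forall k, (k <= r)%N -> phi`_k = f`_(r - k).

(* [f] is [phi] reversed, so multiplication by [phi] in [t] reads as a
   convolution against the coefficients of [f] in [x]. *)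
Lemma reverse_conv (P V : {poly A}) (g : nat -> A) s :
  (forall k, (k <= r)%N -> P`_k = g (r - k)%N) ->
  (forall k, (r < k)%N -> g k = 0) ->
  \sum_(b < r.+1) g (s + b)%N * V`_b = if (s <= r)%N then (P * V)`_(r - s) else 0.
Proof.
move=> Pg g0; case: leqP => sr; last first.
  by rewrite big1 // => b _; rewrite g0 ?mul0r // ltn_addr.
have rsr : ((r - s).+1 <= r.+1)%N by rewrite ltnS leq_subr.
rewrite coefMr (big_ord_widen _ (fun j => P`_(r - s - j) * V`_j) rsr) [RHS]big_mkcond /=.
apply: eq_bigr => b _; case: ltnP => bs; last by rewrite g0 ?mul0r //; lia.
by rewrite Pg; [congr (g _ * _); lia|lia].
Qed.

Variables (i : nat) (V : {poly A}).
Hypothesis i_r : (0 < i < r)%N.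
Hypothesis ode : root_ode r phi i V.
Hypothesis V0 : V`_0 = 0.

(* The polynomial part, in [x], of [f * f^(-i/r)]. *)
Definition polar_part : {poly A} := \poly_(s < r.+1) (phi * V)`_(r - s).
Local Notation H := polar_part.

Let f_gt k : (r < k)%N -> f`_k = 0.
Proof. by move=> rk; rewrite nth_default // (leq_trans size_f). Qed.

(** The convolution of [reverse_conv] loses its end terms: [V_0 = 0] at one end, [f_(s+r) = 0] for
    [s > 0] at the other. *)
Let sum_f s : (0 < s)%N -> \sum_(b < r.-1) f`_(s + b).+1 * V`_b.+1 = H`_s.
Proof.
move=> s0; rewrite coef_poly ltnS -(reverse_conv V s phi_f f_gt).
have [r' Dr] : exists r', r = r'.+1 by exists r.-1; lia.
rewrite Dr big_ord_recr big_ord_recl /= V0 mulr0 add0r f_gt ?mul0r ?addr0; last by lia.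
by apply: eq_bigr => b _; rewrite -addnS.
Qed.

(** The numbers [(r - k) f_k] are the coefficients of [theta phi] read backwards, and the
    differential equation of [phi V] expresses the coefficients of [theta phi * V] by those of
    [phi V]. *)
Let sum_df s : (r - i)%:R * \sum_(b < r.-1)
    (r%:R - (s + b).+1%:R) * f`_(s + b).+1 * V`_b.+1
  = r%:R * ((r - i)%:R - s%:R) * H`_s.
Proof.
pose g k := (r%:R - k%:R) * f`_k.
transitivity ((r - i)%:R * \sum_(b < r.+1) g (s + b)%N * V`_b).
  congr (_ * _); have [r' Dr] : exists r', r = r'.+1 by exists r.-1; lia.
  rewrite Dr [RHS]big_ord_recr [X in _ = X + _]big_ord_recl /= V0 mulr0 add0r -Dr.
  rewrite /g [X in _ + X](_ : _ = 0) ?addr0.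
    by apply: eq_bigr => b _; rewrite -addnS.
  (* At [s = 0] the boundary term dies by the factor [r - r], for [s > 0] because [f] has degree at
     most [r]. *)
  by case: s => [|s]; rewrite ?subrr ?mul0r // f_gt ?mulr0 ?mul0r //; lia.
rewrite (@reverse_conv (theta phi)); first last.
- by move=> k rk; rewrite /g f_gt ?mulr0.
- by move=> k kr; rewrite coef_theta phi_f // /g natrB // subKr.
rewrite coef_poly ltnS; case: leqP => sr; last by rewrite !mulr0.
have ir : (i <= r)%N by lia.
have := coef_root_phiM ir ode (leq_subr s r).
move: (phi * V)`_(r - s) (_ * V)`_(r - s) => x y E.
apply: (addrI ((i * r)%:R * x)); rewrite -E !natrB // natrM; ring.
Qed.

(** The right side is [r] times the numerator of the derivative of [H f^(-(r-i)/r)]. Expanding along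
    the coefficients of [f] and [f'] leaves sums over [b] that [sum_f] and [sum_df] evaluate. *)
Lemma bezout_polar_part a :
  (r - i)%:R * \sum_(b < r.-1)
     bez_coef f^`() (f - rho%:P * ('X * f^`())) a b * V`_b.+1
  = (r%:R * f * H^`() - (r - i)%:R * f^`() * H)`_a.
Proof.
have coefG k : (f - rho%:P * ('X * f^`()))`_k = rho * ((r%:R - k%:R) * f`_k).
  rewrite coefB coefCM -/(theta f) coef_theta.
  by rewrite [RHS]mulrA mulrBr rhoK mulrBl mul1r mulrA.
set G := f - _ in coefG *.
(* Since [r f - theta f] is [r] times [G], this gives the right side the antisymmetric shape of the
   Bezout coefficients. *)
have -> : r%:R * f * H^`() - (r - i)%:R * f^`() * H
  = (r%:R * f - theta f) * H^`() - f^`() * ((r - i)%:R * H - theta H).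
  by rewrite /theta; ring.
rewrite coefB !coefM -sumrB.
under eq_bigr => b _ do rewrite mulr_suml.
rewrite exchange_big mulr_sumr; apply: eq_bigr => c _ /=.
set s := (a - c)%N.
transitivity (rho * (r%:R - c%:R) * f`_c *
     ((r - i)%:R * (r%:R * (\sum_(b < r.-1) f`_(s.+1 + b).+1 * V`_b.+1)
       - \sum_(b < r.-1) (r%:R - (s.+1 + b).+1%:R) * f`_(s.+1 + b).+1 * V`_b.+1))
   - rho * f^`()`_c * ((r - i)%:R * \sum_(b < r.-1)
       (r%:R - (s + b).+1%:R) * f`_(s + b).+1 * V`_b.+1)).
  rewrite ![_ * (_%:R * _)]mulrCA -mulrBr; congr (_ * _).
  rewrite mulr_sumr -sumrB !mulr_sumr -sumrB; apply: eq_bigr => b _.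
  rewrite (_ : a + b - c = s + b)%N; last by rewrite /s; have := ltn_ord c; lia.
  by rewrite !coefG [X in X * (rho * _)]coef_deriv addSn -[X in X * (rho * _)]mulr_natl; ring.
rewrite sum_f // [(r - i)%:R * (_ - \sum_(_ < _) _)]mulrBr (sum_df s.+1) (sum_df s).
rewrite -!polyC_natr !coefB !coefCM !coef_theta [in RHS]coef_deriv -[_ *+ s.+1]mulr_natl.
transitivity ((rho * r%:R) * ((r%:R - c%:R) * f`_c * (s.+1%:R * H`_s.+1)
   - f^`()`_c * (((r - i)%:R - s%:R) * H`_s))).
  by ring.
by rewrite rhoK; ring.
Qed.
End BezoutRoot.

(** * Pole reduction *)

Lemma sum_interior_rev (R : nmodType) (r : nat) (g : nat -> R) : (0 < r)%N ->
  g 0%N = 0 -> g r = 0 -> \sum_(l < r.+1) g l = \sum_(a < r.-1) g (r - a.+1)%N.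
Proof.
case: r => // r _ g0 gr.
rewrite big_ord_recl big_ord_recr /= g0 gr add0r addr0 (reindex_inj rev_ord_inj) /=.
by apply: eq_bigr => a _; congr (g _); rewrite /bump /=; have := ltn_ord a; lia.
Qed.

Section Reduction.
Variables (A : idomainType) (r : nat) (phi f : {poly A}) (V : nat -> {poly A}).
Variable (inv : nat -> A).
Hypothesis r_gt1 : (1 < r)%N.
Hypothesis invK : forall k, (0 < k)%N -> inv k * k%:R = 1.
Hypothesis size_f : (size f <= r.+1)%N.
Hypothesis phi_0 : phi`_0 = 1.
Hypothesis phi_f : forall k, (k <= r)%N -> phi`_k = f`_(r - k).
Hypothesis ode : forall i, root_ode r phi i (V i).
Hypothesis V_low : forall i, exists2 E : {poly A}, V i = 'X^i * E & E`_0 = 1.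

Local Notation m_ i := (r - i.+1)%N.
Local Notation H i := (polar_part r phi (V i)).

Let natA_neq0 k : (0 < k)%N -> k%:R != 0 :> A.
Proof.
move=> k0; apply/eqP => E; have := invK k0; rewrite E mulr0 => /eqP.
by rewrite eq_sym oner_eq0.
Qed.

Let natA_inj k l : k%:R = l%:R :> A -> k = l.
Proof.
wlog kl : k l / (k <= l)%N => [W|].
  by case: (leqP k l) => [|/ltnW] kl E; [|symmetry]; apply: W.
move=> E; apply/eqP; rewrite eqn_leq kl -subn_eq0 -leqn0 leqNgt.
by apply/negP => /natA_neq0/eqP; apply; rewrite natrB // E subrr.
Qed.

Lemma V_lt i l : (l < i)%N -> (V i)`_l = 0.
Proof. by move=> li; have [E -> _] := V_low i; rewrite coefXnM li. Qed.

Lemma V_lead i : (V i)`_i = 1.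
Proof. by have [E -> E0] := V_low i; rewrite coefXnM ltnn subnn. Qed.

Lemma phiV_lt i l : (l < i)%N -> (phi * V i)`_l = 0.
Proof. by move=> li; have [E -> _] := V_low i; rewrite mulrCA coefXnM li. Qed.

Lemma phiV_lead i : (phi * V i)`_i = 1.
Proof.
by have [E -> E0] := V_low i; rewrite mulrCA coefXnM ltnn subnn coef0M phi_0 E0 mulr1.
Qed.

(** Off the diagonal this is [coef_root_ortho]. On it the factors start at degrees [m_ k] and
    [k.+1], which add up to [r], so only the leading terms meet. *)
Lemma root_series_ortho (i k : 'I_(r.-1)) :
  (theta (V (m_ i)) * (phi * V k.+1))`_r = ((i == k) * m_ k)%:R.
Proof.
have kr : (r - m_ k = k.+1)%N by have := ltn_ord k; lia.
have mr : (m_ k <= r)%N by rewrite leq_subr.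
have [->|nik] := eqVneq i k; last first.
  have odek : root_ode r phi (r - m_ k) (V k.+1) by rewrite kr; apply: ode.
  have := coef_root_ortho phi_0 mr (ode (m_ i)) odek.
  move/eqP; rewrite !mulf_eq0 => /orP[|/eqP->]; last by rewrite mul0n.
  rewrite subr_eq0 (negPf (natA_neq0 _)) ?(ltnW r_gt1) //= => /eqP/natA_inj E.
  by case/negP: nik; apply/eqP/val_inj => /=; have := ltn_ord i; have := ltn_ord k; lia.
rewrite mul1n coefM.
rewrite (bigD1 (Ordinal (mr : m_ k < r.+1)%N)) //= [X in _ + X]big1 => [|l ll].
  by rewrite addr0 coef_theta kr V_lead phiV_lead !mulr1.
rewrite coef_theta; have : (l : nat) != m_ k by rewrite -val_eqE in ll.
rewrite neq_ltn => /orP[|] lt; first by rewrite V_lt // mulr0 mul0r.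
by rewrite phiV_lt ?mulr0 //; have := ltn_ord l; have := ltn_ord k; lia.
Qed.

Definition P_mx : 'M[A]_(r.-1) := \matrix_(i, j) (V (m_ i))`_(m_ j).
Definition Q_mx : 'M[A]_(r.-1) := \matrix_(i, j) (V j.+1)`_(i.+1).
(** The reversed row index [r.-2 - i] accounts for the factor [J]. *)
Definition B_mx : 'M[A]_(r.-1) :=
  \matrix_(i, j) bez_coef f^`() (f - (inv r)%:P * ('X * f^`())) (r.-2 - i) j.

(** Orthogonality makes [P_mx] a left inverse of the coefficient matrix [S] of the polynomials
    [theta (H i.+1) / m_ i]; for square matrices it is also a right inverse, which is the claim. *)
Lemma polar_part_inverse (j : 'I_(r.-1)) :
  \sum_(i < r.-1) (inv (m_ i) * P_mx i j)%:P * theta (H i.+1) = 'X^(m_ j).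
Proof.
pose S : 'M[A]_(r.-1) :=
  \matrix_(a, i) (inv (m_ i) * ((m_ a)%:R * (H i.+1)`_(m_ a))).
have PS : P_mx *m S = 1%:M.
  apply/matrixP => i k; rewrite !mxE.
  transitivity (inv (m_ k) * (theta (V (m_ i)) * (phi * V k.+1))`_r); last first.
    rewrite root_series_ortho; have [_|_] := eqVneq i k; last by rewrite mulr0.
    by rewrite mul1n invK //; have := ltn_ord k; lia.
  rewrite coefM; have r_gt0 := ltnW r_gt1.
  rewrite (sum_interior_rev (g := fun l => (theta (V (m_ i)))`_l * (phi * V k.+1)`_(r - l))) //.
  - rewrite mulr_sumr; apply: eq_bigr => a _.
    by rewrite !mxE coef_poly ltnS leq_subr coef_theta; ring.
  - by rewrite coef_theta !mul0r.
  by rewrite subnn phiV_lt ?mulr0.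
have SP := mulmx1C PS.
apply/polyP => l; rewrite coef_sum coefXn.
under eq_bigr => i _ do rewrite coefCM coef_theta.
have jr := ltn_ord j.
case: (boolP (0 < l < r)%N) => [/andP[l0 lr]|lr].
  have ar : (m_ l < r.-1)%N by lia.
  have /matrixP/(_ (Ordinal ar) j) := SP; rewrite !mxE -val_eqE /=.
  have -> : (m_ l == j) = (l == m_ j) by apply/eqP/eqP; lia.
  move=> <-; apply: eq_bigr => i _; rewrite !mxE /=.
  have -> : (m_ (m_ l) = l)%N by lia.
  by ring.
(* Outside [0 < l < r] both sides vanish: [theta] kills degree 0, and [H_r] is the constant term of
   [phi V], which is 0. *)
rewrite (_ : (l == m_ j) = false); last by apply/eqP; lia.
rewrite big1 // => i _; have [->|l0] := eqVneq l 0%N; first by rewrite mul0r mulr0.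
rewrite coef_poly; case: ifP => lr'; last by rewrite !mulr0.
by rewrite phiV_lt ?mulr0 //; lia.
Qed.

(** Column [i] of [Q_mx] lists coefficients of [V i.+1], so this is [bezout_polar_part] in matrix
    form, the Bezout coefficients stopping at degree [r - 2] in [x]. *)
Lemma BQ_polar (i : 'I_(r.-1)) :
  (m_ i)%:R * \sum_(k < r.-1) ((B_mx *m Q_mx) k i)%:P * 'X^(r.-2 - k)
  = r%:R * f * (H i.+1)^`() - (m_ i)%:R * f^`() * H i.+1.
Proof.
have ir := ltn_ord i.
have i_r : (0 < i.+1 < r)%N by lia.
have V0 : (V i.+1)`_0 = 0 by rewrite V_lt.
have bez := bezout_polar_part (invK (ltnW r_gt1)) size_f phi_f i_r (ode i.+1) V0.
apply/polyP => a; rewrite -bez -polyC_natr coefCM; congr (_ * _).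
rewrite coef_sum; have [ar|ra] := ltnP a r.-1.
  have kr : (r.-2 - a < r.-1)%N by lia.
  rewrite (bigD1 (Ordinal kr)) //= [X in _ + X]big1 => [|k nk]; last first.
    rewrite coefCM coefXn (_ : (_ == _) = false) ?mulr0 //; apply/eqP => E.
    by case/eqP: nk; apply/val_inj => /=; have := ltn_ord k; lia.
  rewrite addr0 coefCM coefXn (_ : (_ == _) = true); last by apply/eqP; lia.
  rewrite mulr1 mxE; apply: eq_bigr => b _; rewrite !mxE /=.
  by have -> : (r.-2 - (r.-2 - a) = a)%N by lia.
rewrite !big1 // => [b|k] _; last first.
  by rewrite coefCM coefXn (_ : (_ == _) = false) ?mulr0 //; apply/eqP; lia.
rewrite (@bez_coef_eq0 _ _ _ r) ?mul0r //.
  by apply/leq_sizeP => k rk; rewrite coef_deriv nth_default ?mul0rn // (leq_trans size_f).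
apply/leq_sizeP => k rk; rewrite coefB coefCM -/(theta f) coef_theta.
(* The factor [1 - k/r] removes the term of degree [r], so the second Bezout argument also has size
   at most [r]. *)
have [<-|nk] := eqVneq r k; first by rewrite mulrA invK ?mul1r ?subrr //; lia.
rewrite nth_default ?mulr0 ?subrr //; apply: leq_trans size_f _.
by move: nk rk; clear; case: ltngtP.
Qed.

Variable n : nat.
Hypothesis n_gt0 : (0 < n)%N.

Definition Z_mx : 'M[A]_(r.-1) :=
  \matrix_(i, j) if i == j then n%:R * inv (r * n - m_ i) else 0.

(** [H i.+1] is the polynomial part of [u^(m_ i)], and integrating [u^(m_ i - r n) du/u] produces
    the factor [- 1 / (r n - m_ i)]. *)
Definition primitive (j : 'I_(r.-1)) : {poly A} :=
  - \sum_(i < r.-1) (inv (r * n - m_ i) * P_mx i j)%:P * H i.+1.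

(** Divided by [f^(n+1)], the left side is [x^(m_ j) f^(-n)] minus the exact term
    [x d/dx (h f^(-n))], where [h] is the primitive. It is expanded by [polar_part_inverse] and
    brought back to monomials by [BQ_polar]. *)
Lemma reduction_step (j : 'I_(r.-1)) :
  'X^(m_ j) * f - theta (primitive j) * f + n%:R * (theta f * primitive j)
  = \sum_(k < r.-1) ((B_mx *m Q_mx *m Z_mx *m P_mx) k j)%:P * 'X^(m_ k).
Proof.
transitivity (\sum_(i < r.-1) (n%:R * inv (r * n - m_ i) * P_mx i j)%:P
   * 'X * \sum_(k < r.-1) ((B_mx *m Q_mx) k i)%:P * 'X^(r.-2 - k)); last first.
  under eq_bigr => i _ do rewrite mulr_sumr.
  rewrite exchange_big; apply: eq_bigr => k _ /=.
  rewrite [in RHS]mxE rmorph_sum mulr_suml; apply: eq_bigr => i _ /=.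
  rewrite [(_ *m Z_mx) _ _]mxE (bigD1 i) //= big1 => [|l li]; last first.
    by rewrite [Z_mx _ _]mxE (negPf li) mulr0.
  rewrite [Z_mx _ _]mxE eqxx addr0.
  have -> : (m_ k = (r.-2 - k).+1)%N by have := ltn_ord k; lia.
  by rewrite exprS !polyCM; ring.
rewrite -polar_part_inverse /primitive.
have theta_sum I (s : seq I) F : theta (\sum_(i <- s) F i) = \sum_(i <- s) theta (F i).
  by rewrite /theta raddf_sum mulr_sumr.
have thetaN P : theta (- P) = - theta P by rewrite /theta derivN mulrN.
have thetaC c P : theta (c%:P * P) = c%:P * theta P.
  by rewrite thetaM {1}/theta derivC mulr0 mul0r add0r.
rewrite thetaN theta_sum mulNr opprK mulrN mulrN !mulr_suml !mulr_sumr -big_split -sumrB /=.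
apply: eq_bigr => i _; rewrite thetaC.
have ir := ltn_ord i.
set m := m_ i; have m0 : (0 < m)%N by rewrite /m; lia.
have z0 : (0 < r * n - m)%N by rewrite /m; have := leq_pmulr r n_gt0; lia.
set S := \sum_(k < r.-1) _.
have DS : S = (inv m)%:P * (r%:R * f * (H i.+1)^`() - m%:R * f^`() * H i.+1).
  rewrite -BQ_polar -/S mulrA -/m -[m%:R in RHS]polyC_natr -polyCM invK //.
  by rewrite polyC1 mul1r.
(* Partial fractions: [1/m] comes from [polar_part_inverse] and [1/(r n - m)] from the primitive;
   their sum yields the entry [n / (r n - m)] of [Z_mx]. *)
have inv_add : inv m + inv (r * n - m) = r%:R * n%:R * (inv m * inv (r * n - m)).
  have Dz : (r * n - m)%:R = r%:R * n%:R - m%:R :> A.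
    by rewrite natrB ?natrM //; lia.
  have E1 := invK m0; have := invK z0; rewrite Dz => E2.
  transitivity (inv m * (inv (r * n - m) * (r%:R * n%:R - m%:R))
                + (inv m * m%:R) * inv (r * n - m)); first by rewrite E1 E2; ring.
  by ring.
have xm : (inv m)%:P * m%:R = 1 by rewrite -polyC_natr -polyCM invK.
have xy : (inv m)%:P + (inv (r * n - m))%:P
    = r%:R * n%:R * ((inv m)%:P * (inv (r * n - m))%:P).
  by rewrite -!polyC_natr -!polyCM -polyCD inv_add.
rewrite DS /theta !polyCM polyC_natr.
move: (inv m)%:P (inv (r * n - m))%:P (P_mx i j)%:P (H i.+1) xm xy => x y P h xm xy.
transitivity ('X * P * ((x + y) * h^`() * f - n%:R * y * f^`() * h)); first by ring.
transitivity ('X * P * ((x + y) * h^`() * f - (x * m%:R) * n%:R * y * f^`() * h)).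
  by rewrite xm mul1r.
by rewrite xy; ring.
Qed.
End Reduction.

(** * The series of [f^(-m/r)] over the rationals *)

Section Rational.
Variable r : nat.
Hypothesis r_gt1 : (1 < r)%N.
Local Notation A := {mpoly rat[r]}.
Local Notation f := (fpoly rat r).
Local Notation phi := (phi r).

Definition root_series (m : nat) : {poly A} :=
  'X^m * binpow r r (- (m%:R) / r%:R).
Local Notation V := root_series.

Lemma natr_rat_neq0 k : (0 < k)%N -> k%:R != 0 :> rat.
Proof. by move=> k0; rewrite Num.Theory.pnatr_eq0 -lt0n. Qed.

Lemma coef_root_series m l : (l <= r)%N ->
  (V m)`_l = beta r (- (m%:R) / r%:R) (l%:Z - m%:Z).
Proof.
move=> lr; rewrite coefXnM; case: ltnP => lm.
  by rewrite beta_neg //; lia.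
rewrite coef_binpow; last by lia.
by congr (beta _ _ _); lia.
Qed.

(** The algebra behind [root_series_ode]: [xm], [E], [q], [u] stand for [X^m], the binomial series,
    [(phi - 1)^r] and [X^(r+1)]; [n * lam = - m] encodes the exponent [-m/r]. *)
Lemma root_ode_ring (R : comNzRingType) (m n : R) (x xm phi' p' E E' lam c u q psi : R) :
  phi' * E' = lam * p' * E - c * p' * q -> n * lam = - m -> x * q = u * psi ->
  n * phi' * (m * xm * E + x * xm * E')
  = m * (n * phi' - x * p') * (xm * E) + u * (- n * c * xm * p' * psi).
Proof.
move=> ode nl xq.
transitivity (m * n * phi' * xm * E + n * x * xm * (phi' * E')); first by ring.
rewrite ode.
transitivity (m * n * phi' * xm * E + (n * lam) * x * xm * p' * E - n * xm * c * p' * (x * q)).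
  by ring.
by rewrite nl xq; ring.
Qed.

(** The truncation error contains [(phi - 1)^r], divisible by [t^r]; the factor [t] of [theta]
    supplies the missing power. *)
Lemma root_series_ode m : root_ode r phi m (V m).
Proof.
have [psi Dpsi] := phiB1 r.
set lam := - (m%:R) / r%:R : rat.
exists (- r%:R * ((binr lam r.+1)%:MP * r.+1%:R)%:P * 'X^m * phi^`() * psi ^+ r).
have -> : theta (V m) = m%:R * 'X^m * binpow r r lam + 'X * 'X^m * (binpow r r lam)^`().
  rewrite /V thetaM -/lam /theta [X in X * _ + _ = _](_ : _ = m%:R * 'X^m).
    by rewrite mulrCA !mulrA.
  by rewrite derivXn; case: m {lam} => [|m]; rewrite ?mulr0n ?mul0r ?mulr0 // mulrnAr -exprS mulr_natl.
apply: root_ode_ring (binpow_ode r r lam) _ _; last first.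
  by rewrite Dpsi exprMn mulrA -exprS.
have natC n : n%:R = (((n%:R : rat)%:MP)%:P : {poly A}).
  by rewrite -polyC_natr -(rmorph_nat (@mpolyC r rat)).
rewrite (natC r) (natC m) -!rmorphM -!rmorphN /=; congr (_%:MP%:P).
by rewrite /lam mulrCA divff ?mulr1 // natr_rat_neq0 // ltnW.
Qed.

Lemma coef0_binpow lam : (binpow r r lam)`_0 = 1.
Proof.
rewrite coef_binpow // /beta /= big_ord1 expr0 coef1 mulr1 /binr big_ord0 fact0 divr1.
exact: mpolyC1.
Qed.

End Rational.

(** * Reduction modulo p *)

(* [redp] is a morphism only on [p]-integral rationals, so reduction is handled
   as a relation compatible with the ring operations. *)
Record ring_rel (A B : comNzRingType) (R : A -> B -> Prop) : Prop := RingRel {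
  rel0 : R 0 0;
  rel1 : R 1 1;
  relN : forall a b, R a b -> R (- a) (- b);
  relD : forall a b a' b', R a b -> R a' b' -> R (a + a') (b + b');
  relM : forall a b a' b', R a b -> R a' b' -> R (a * a') (b * b') }.

Section RingRel.
Variables (A B : comNzRingType) (R : A -> B -> Prop).
Hypothesis rR : ring_rel R.

Lemma relB a b a' b' : R a b -> R a' b' -> R (a - a') (b - b').
Proof. by move=> Ra Ra'; apply: relD => //; apply: relN. Qed.

Lemma rel_sum I (s : seq I) (P : pred I) F G :
  (forall i, P i -> R (F i) (G i)) ->
  R (\sum_(i <- s | P i) F i) (\sum_(i <- s | P i) G i).
Proof. by move=> RFG; apply: (big_ind2 R); [exact: rel0 | exact: relD|]. Qed.

Lemma rel_prod I (s : seq I) (P : pred I) F G :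
  (forall i, P i -> R (F i) (G i)) ->
  R (\prod_(i <- s | P i) F i) (\prod_(i <- s | P i) G i).
Proof. by move=> RFG; apply: (big_ind2 R); [exact: rel1 | exact: relM|]. Qed.

Lemma rel_muln a b k : R a b -> R (a *+ k) (b *+ k).
Proof.
by move=> Ra; elim: k => [|k IH]; rewrite ?mulr0n ?mulrS; [exact: rel0|exact: relD].
Qed.

Lemma rel_exp a b k : R a b -> R (a ^+ k) (b ^+ k).
Proof.
by move=> Ra; elim: k => [|k IH]; rewrite ?expr0 ?exprS; [exact: rel1|exact: relM].
Qed.

Lemma rel_nat k : R k%:R k%:R.
Proof. by apply: rel_muln; exact: rel1. Qed.

Definition poly_rel (P : {poly A}) (Q : {poly B}) := forall k, R P`_k Q`_k.

Lemma poly_relP : ring_rel poly_rel.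
Proof.
split.
- by move=> k; rewrite !coef0; apply: rel0.
- by move=> k; rewrite !coef1; apply: rel_nat.
- by move=> P Q RPQ k; rewrite !coefN; apply: relN.
- by move=> P Q P' Q' RPQ RPQ' k; rewrite !coefD; apply: relD.
by move=> P Q P' Q' RPQ RPQ' k; rewrite !coefM; apply: rel_sum => i _; apply: relM.
Qed.

Lemma poly_relC a b : R a b -> poly_rel a%:P b%:P.
Proof. by move=> Ra k; rewrite !coefC; case: ifP => _ //; apply: rel0. Qed.

Lemma poly_relX : poly_rel 'X 'X.
Proof. by move=> k; rewrite !coefX; apply: rel_nat. Qed.

Lemma poly_rel_deriv P Q : poly_rel P Q -> poly_rel P^`() Q^`().
Proof. by move=> RPQ k; rewrite !coef_deriv; apply: rel_muln. Qed.

Variable n : nat.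
Definition mpoly_rel (P : {mpoly A[n]}) (Q : {mpoly B[n]}) :=
  forall m, R P@_m Q@_m.

Lemma mpoly_relP : ring_rel mpoly_rel.
Proof.
split.
- by move=> m; rewrite !mcoeff0; apply: rel0.
- by move=> m; rewrite !mcoeff1; apply: rel_nat.
- by move=> P Q RPQ m; rewrite !mcoeffN; apply: relN.
- by move=> P Q P' Q' RPQ RPQ' m; rewrite !mcoeffD; apply: relD.
by move=> P Q P' Q' RPQ RPQ' m; rewrite !mcoeffM; apply: rel_sum => i _; apply: relM.
Qed.

Lemma mpoly_relC a b : R a b -> mpoly_rel a%:MP b%:MP.
Proof.
by move=> Ra m; rewrite !mcoeffC; apply: relM => //; apply: rel_nat.
Qed.

Lemma mpoly_relX (i : 'I_n) : mpoly_rel 'X_i 'X_i.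
Proof. by move=> m; rewrite !mcoeffX; apply: rel_nat. Qed.

End RingRel.

Section ReductionModp.
Variable p : nat.
Hypothesis p_pr : prime p.

(** Fractions need not be in lowest terms, so closure under the ring operations requires no
    normalisation. *)
Definition red_rel (q : rat) (x : 'F_p) := exists a b : int,
  [/\ ~~ (p %| `|b|)%N, q = a%:~R / b%:~R & x = a%:~R / b%:~R].

Lemma Fp_intr_eq0 (b : int) : ((b%:~R : 'F_p) == 0) = (p %| `|b|)%N.
Proof.
have pc := pchar_Fp p_pr.
by case: b => k; rewrite ?NegzE ?abszN /= ?mulrNz ?oppr_eq0 (dvdn_pcharf pc).
Qed.

Let Fp_den (b : int) : ~~ (p %| `|b|)%N -> (b%:~R : 'F_p) != 0 /\ (b%:~R : rat) != 0.
Proof.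
move=> nb; rewrite Fp_intr_eq0 nb intr_eq0; split=> //.
by apply/eqP => b0; rewrite b0 dvdn0 in nb.
Qed.

Lemma red_relP : ring_rel red_rel.
Proof.
have p1 : ~~ (p %| 1)%N by rewrite dvdn1; case: p p_pr => [|[]].
split.
- by exists 0, 1; rewrite !mul0r.
- by exists 1, 1; rewrite !divr1.
- move=> _ _ [a [b [nb -> ->]]]; exists (- a), b.
  by rewrite !mulrNz !mulNr.
- move=> _ _ _ _ [a [b [nb -> ->]]] [a' [b' [nb' -> ->]]].
  exists (a * b' + a' * b), (b * b').
  have [[b0 bq] [b0' bq']] := (Fp_den nb, Fp_den nb').
  rewrite abszM Euclid_dvdM // negb_or nb nb' !intrD !intrM.
  by rewrite -!addf_div.
move=> _ _ _ _ [a [b [nb -> ->]]] [a' [b' [nb' -> ->]]].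
exists (a * a'), (b * b').
have [[b0 bq] [b0' bq']] := (Fp_den nb, Fp_den nb').
rewrite abszM Euclid_dvdM // negb_or nb nb' !intrM.
by rewrite -!mulf_div.
Qed.

Lemma red_rel_natV k : ~~ (p %| k)%N -> red_rel (k%:R)^-1 (k%:R)^-1.
Proof. by move=> pk; exists 1, k%:Z; rewrite !mul1r. Qed.

(** From [a * denq q = numq q * b] and coprimality, [denq q] divides [b], hence is prime to [p]. *)
Lemma red_rel_redp q x : red_rel q x -> pint p q /\ redp p q = x.
Proof.
move=> [a [b [nb Dq ->]]]; have [b0 bq] := Fp_den nb.
have bz : b != 0 by rewrite -(intr_eq0 rat).
have E : a * denq q = numq q * b.
  apply: (@intr_inj rat); rewrite !intrM /=.
  have dq : ((denq q)%:~R : rat) != 0 by rewrite intr_eq0 denq_neq0.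
  by apply/eqP; rewrite -eqr_div // -Dq divq_num_den.
have dvd : (`|denq q| %| `|b|)%N.
  have : (`|denq q| %| `|numq q| * `|b|)%N by rewrite -abszM -E abszM dvdn_mull.
  by rewrite Gauss_dvdr // coprime_sym coprime_num_den.
have pd : ~~ (p %| `|denq q|)%N by apply: contra nb => /dvdn_trans; apply.
split=> //; have [d0 _] := Fp_den pd; rewrite /redp.
apply/eqP; rewrite eqr_div //; apply/eqP.
by rewrite -!intrM E.
Qed.

End ReductionModp.

(** * Coefficients modulo p and nonsingularity *)

(** With [d = r - 1] the index is [i p - (r - j)], and the value zero at negative indices agrees
    with multiplication by [X^(r-j)]. *)
Lemma MmxE (A : comNzRingType) (p r : nat) (g : {poly A}) (i j : 'I_(r.-1)) :
  Mmx p r.-1 g i j = ('X^(r - j.+1) * g)`_(i.+1 * p).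
Proof.
have jr := ltn_ord j; rewrite mxE /coefz coefXnM.
have -> : ((i.+1 * p + j.+1)%N%:Z - (r.-1)%:Z - 1 < 0)%R = (i.+1 * p < r - j.+1)%N.
  by apply/idP/idP; lia.
by case: ifP => // le; congr (g`_ _); lia.
Qed.

Lemma map_Mmx (A B : nzRingType) (u : {rmorphism A -> B}) p d (g : {poly A}) :
  map_mx u (Mmx p d g) = Mmx p d (map_poly u g).
Proof.
apply/matrixP => i j; rewrite !mxE /coefz.
by case: ifP; rewrite ?rmorph0 ?coef_map.
Qed.

(** Since [n = -(e+1)] modulo [p], multiplying the reduction step by [f^e] makes its correction the
    term [x d/dx (h f^(e+1))], whose coefficient at [x^(ip)] is a multiple of [p]. *)
Lemma Mmx_exp_recurrence (A : comNzRingType) (p r e n : nat) (f : {poly A})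
    (N : 'M[A]_(r.-1)) :
  p%:R = 0 :> A -> (e.+1 + n = p)%N ->
  (forall j : 'I_(r.-1), exists h : {poly A},
    'X^(r - j.+1) * f - 'X * h^`() * f + n%:R * ('X * f^`() * h)
    = \sum_(k < r.-1) (N k j)%:P * 'X^(r - k.+1)) ->
  Mmx p r.-1 (f ^+ e.+1) = Mmx p r.-1 (f ^+ e) *m N.
Proof.
move=> p0 enp step; apply/matrixP => i j; rewrite MmxE mxE.
have {step} [g step] := step j.
have n_e : n%:R = - (e.+1)%:R :> {poly A}.
  apply/eqP; rewrite -addr_eq0 addrC -natrD enp -polyC_natr p0; exact/eqP.
have E : 'X^(r - j.+1) * f ^+ e.+1 =
   (\sum_(k < r.-1) (N k j)%:P * 'X^(r - k.+1)) * f ^+ e + 'X * (g * f ^+ e.+1)^`().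
  rewrite -step derivM deriv_exp /= -mulr_natl n_e exprS; ring.
rewrite E coefD [X in _ + X](_ : _ = 0) ?addr0; last first.
  rewrite coefXM; case: eqP => // /eqP; rewrite -lt0n => ip.
  by rewrite coef_deriv -mulr_natr prednK // natrM p0 !mulr0.
rewrite mulr_suml coef_sum; apply: eq_bigr => k _.
by rewrite MmxE -mulrA coefCM mulrC.
Qed.

Lemma prime_ndvd_fact p m : prime p -> (m < p)%N -> ~~ (p %| m`!)%N.
Proof.
move=> p_pr; elim: m => [|m IH] mp; first by rewrite fact0 dvdn1; case: p p_pr mp => [|[]].
by rewrite factS Euclid_dvdM // negb_or IH 1?ltnW // andbT gtnNdvd.
Qed.

Lemma prime_ndvd_bin p m k : prime p -> (k <= m < p)%N -> ~~ (p %| 'C(m, k))%N.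
Proof.
move=> p_pr /andP[km mp]; apply: contra (prime_ndvd_fact p_pr mp) => pC.
by rewrite -(bin_fact km) dvdn_mulr.
Qed.

(** * The specialisation [f = x^r + 1] *)

Section Specialization.
Variables (F : fieldType) (p r e : nat).
Hypothesis p_F : p \in [pchar F].
Hypotheses (r_gt1 : (1 < r)%N) (r_lt_p : (r < p)%N) (e_lt_p : (e < p)%N).
Hypothesis r_e : (r * (p.-1 - e) <= p.-1)%N.
Let p_pr : prime p. Proof. by case/andP: p_F. Qed.

Lemma coef_binomial_exp m :
  ((('X^r + 1 : {poly F}) ^+ e)`_m = if (r %| m)%N then ('C(e, m %/ r))%:R else 0).
Proof.
rewrite exprD1n coef_sum; case: ifP => [/dvdnP[k ->]|rm].
  rewrite mulnK; last exact: ltnW.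
  have E i : ('X^r ^+ i *+ 'C(e, i))`_(k * r) = (i == k)%:R * ('C(e, i))%:R :> F.
    by rewrite coefMn -exprM mulnC coefXn eqn_pmul2r 1?ltnW // [k == i]eq_sym mulr_natr.
  under eq_bigr do rewrite E.
  have [ke|ek] := ltnP k e.+1; last first.
    rewrite bin_small // big1 // => i _; rewrite (_ : (_ == _) = false) ?mul0r //.
    by apply/eqP; have := ltn_ord i; lia.
  rewrite (bigD1 (Ordinal ke)) //= eqxx mul1r big1 ?addr0 // => i ik.
  by rewrite (_ : (_ == _) = false) ?mul0r //; apply/eqP => E'; case/eqP: ik; apply/val_inj.
rewrite big1 // => i _; rewrite coefMn -exprM coefXn (_ : (_ == _) = false) ?mul0rn //.
by apply/eqP => E; rewrite E dvdn_mulr in rm.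
Qed.

Let cop_rp : coprime r p.
Proof. by rewrite coprime_sym prime_coprime // gtnNdvd // ltnW. Qed.

Let M := Mmx p r.-1 (('X^r + 1 : {poly F}) ^+ e).

Let M_dvd (i j : 'I_(r.-1)) : M i j != 0 -> (r %| i.+1 * p + j.+1)%N.
Proof.
rewrite MmxE coefXnM; case: ltnP => [|le]; first by rewrite eqxx.
rewrite coef_binomial_exp; case: ifP; last by rewrite eqxx.
have -> : (i.+1 * p + j.+1 = (i.+1 * p - (r - j.+1)) + r)%N by have := ltn_ord j; lia.
by move=> d _; rewrite dvdn_addl.
Qed.

Let M_neq0 (i j : 'I_(r.-1)) : (r %| i.+1 * p + j.+1)%N -> M i j != 0.
Proof.
have ir := ltn_ord i; have jr := ltn_ord j.
(* Here [i p + j = (q + 1) r] (indices from 1), so the entry is the coefficient of [x^(q r)], namely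
   [binom(e, q)]. *)
move=> /dvdnP[[|q] Dq]; first by move: Dq; rewrite addnS.
have E : (i.+1 * p - (r - j.+1) = q * r)%N by lia.
rewrite MmxE coefXnM ltnNge (_ : (_ <= _)%N = true) /=; last by nia.
rewrite coef_binomial_exp E dvdn_mull // mulnK 1?ltnW //.
rewrite -(dvdn_pcharf p_F) prime_ndvd_bin // e_lt_p andbT leqNgt; apply/negP => eq.
(* If [q > e], then [r (p - 1 - e) + q r >= p r], whereas [q r < (r - 1) p] and
   [r (p - 1 - e) <= p - 1]. *)
have E1 : (p <= (p.-1 - e) + q)%N by lia.
have E2 : (p * r <= (p.-1 - e) * r + q * r)%N by rewrite -mulnDl leq_mul2r E1 orbT.
have E3 : (i.+1 * p <= r.-1 * p)%N by rewrite leq_mul2r ir orbT.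
have E4 : (r.-1 * p + p = p * r)%N by rewrite -mulSnr prednK 1?mulnC // ltnW.
move: r_e Dq E2 E3 E4; rewrite mulSn mulnC; lia.
Qed.

(** As [r] is prime to [p], the condition that [r] divides [i p + j] matches each row with exactly
    one column. *)
Lemma det_Mmx_binomial : \det M != 0.
Proof.
have inj i k j : M i j != 0 -> M k j != 0 -> i = k.
  move=> /M_dvd di /M_dvd dk; apply/val_inj.
  wlog ik : i k di dk / (i <= k)%N => [W|].
    by case: (leqP i k) => [|/ltnW] le; [|symmetry]; apply: W.
  have : (r %| (k - i) * p)%N.
    have -> : ((k - i) * p = (k.+1 * p + j.+1) - (i.+1 * p + j.+1))%N.
      by rewrite subnDr -mulnBl subSS.
    by rewrite dvdn_sub.
  rewrite Gauss_dvdl // => d; apply/eqP; rewrite eqn_leq ik -subn_eq0.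
  by rewrite -(modn_small (_ : k - i < r)%N) //; have := ltn_ord k; lia.
have sur i : exists j, M i j != 0.
  (* The column is [r - s] (counted from 1), where [s] is the residue of [i p] modulo [r], nonzero
     because [i < r]. *)
  have ir := ltn_ord i; set s := (i.+1 * p %% r)%N.
  have s0 : s != 0%N.
    apply/negP => /eqP/eqP; rewrite -/(dvdn r _) Gauss_dvdl // => d.
    by have := dvdn_leq (ltn0Sn i) d; lia.
  have sr : (s < r)%N by rewrite ltn_mod ltnW.
  have jr : ((r - s).-1 < r.-1)%N by lia.
  exists (Ordinal jr); apply: M_neq0 => /=.
  rewrite prednK; last by lia.
  rewrite /dvdn -modnDml -/s subnKC 1?ltnW // modnn //.
(* [M] is monomial, so its Gram matrix is diagonal. *)
have E : M *m M^T = diag_mx (\row_i (M *m M^T) i i).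
  apply/matrixP => i k; rewrite [RHS]mxE [in RHS]mxE.
  have [<-|ik] := eqVneq i k; first by rewrite mulr1n.
  rewrite mulr0n mxE big1 // => j _; rewrite [M^T _ _]mxE.
  have [->|Mi] := eqVneq (M i j) 0; first by rewrite mul0r.
  have [->|Mk] := eqVneq (M k j) 0; first by rewrite mulr0.
  by case/eqP: ik; apply: inj Mi Mk.
suff : \det (M *m M^T) != 0 by rewrite det_mulmx mulf_eq0 negb_or => /andP[].
rewrite E det_diag; apply/prodf_neq0 => i _; rewrite mxE [(M *m _) _ _]mxE.
have [j Mij] := sur i.
(* Two nonzero columns in row [i] would differ by a multiple of [r], so the diagonal entry is a
   single square. *)
rewrite (bigD1 j) //= big1 ?addr0 => [|k kj]; first by rewrite [M^T _ _]mxE mulf_neq0.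
have [->|Mik] := eqVneq (M i k) 0; first by rewrite mul0r.
case/eqP: kj; apply/val_inj => /=.
have [di dk] := (M_dvd Mij, M_dvd Mik); have jr := ltn_ord j; have kr := ltn_ord k.
wlog jk : j k Mij Mik di dk jr kr / (j <= k)%N => [W|].
  by case: (leqP j k) => [|/ltnW] le; [|symmetry]; apply: W.
have : (r %| k - j)%N.
  have -> : (k - j = (i.+1 * p + k.+1) - (i.+1 * p + j.+1))%N by lia.
  by rewrite dvdn_sub.
by rewrite /dvdn modn_small; lia.
Qed.
End Specialization.

(** Sending the indeterminates to the roots of [x^r + 1] in a splitting field is a ring morphism,
    and it maps this determinant to a nonzero one. *)
Lemma det_Mmx_fpoly (p r e : nat) :
  prime p -> (1 < r < p)%N -> (e < p)%N -> (r * (p.-1 - e) <= p.-1)%N ->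
  \det (Mmx p r.-1 (fpoly 'F_p r ^+ e)) != 0.
Proof.
move=> p_pr /andP[r1 rp] ep re.
have mon (F : fieldType) : ('X^r + 1 : {poly F}) \is monic.
  by rewrite -polyC1 monicXnaddC // ltnW.
have sz (F : fieldType) : size ('X^r + 1 : {poly F}) = r.+1.
  by rewrite -polyC1 size_XnaddC // ltnW.
have [L [zs Dzs _]] := FinSplittingFieldFor (monic_neq0 (mon 'F_p)).
have {}Dzs : ('X^r + 1 : {poly L}) = \prod_(z <- zs) ('X - z%:P).
  apply/eqP; rewrite -eqp_monic ?mon ?monic_prod_XsubC //.
  by move: Dzs; rewrite rmorphD rmorphXn /= map_polyX rmorph1.
have szs : size zs = r.
  by apply: succn_inj; rewrite -(sz L) Dzs size_prod_XsubC.
have pL : p \in [pchar L] by rewrite pchar_lalg pchar_Fp.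
pose u : {rmorphism {mpoly 'F_p[r]} -> L} := mmap (in_alg L) (fun i : 'I_r => zs`_i).
have Du : map_poly u (fpoly 'F_p r) = 'X^r + 1.
  rewrite Dzs (big_nth 0) szs big_mkord rmorph_prod; apply: eq_bigr => i _.
  rewrite rmorphB /= map_polyX map_polyC /=; congr (_ - _%:P).
  by rewrite mmapX mmap1U.
have := det_Mmx_binomial pL r1 rp ep re.
rewrite -Du -rmorphXn /= -map_Mmx det_map_mx.
by apply: contra => /eqP ->; rewrite rmorph0.
Qed.

(** * Integrality *)

Section RelIntegral.
Variables (A B : comNzRingType) (R : A -> B -> Prop).
Hypothesis rR : ring_rel R.

Definition rel_int a := exists b, R a b.

Lemma rel_intM a b : rel_int a -> rel_int b -> rel_int (a * b).
Proof. by move=> [a' Ra] [b' Rb]; exists (a' * b'); apply: relM. Qed.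

Lemma rel_intD a b : rel_int a -> rel_int b -> rel_int (a + b).
Proof. by move=> [a' Ra] [b' Rb]; exists (a' + b'); apply: relD. Qed.

Lemma rel_intN a : rel_int a -> rel_int (- a).
Proof. by move=> [a' Ra]; exists (- a'); apply: relN. Qed.

Lemma rel_int_nat k : rel_int k%:R.
Proof. by exists k%:R; apply: rel_nat. Qed.

Lemma rel_int0 : rel_int 0. Proof. exact: (rel_int_nat 0). Qed.

Lemma rel_int_sum I (s : seq I) (P : pred I) F :
  (forall i, P i -> rel_int (F i)) -> rel_int (\sum_(i <- s | P i) F i).
Proof. by move=> iF; apply: (big_ind rel_int); [exact: rel_int0|exact: rel_intD|]. Qed.

(** Induction on [P] assembles the separate witnesses for the coefficients into one polynomial. *)
Lemma rel_int_poly (P : {poly A}) :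
  (forall k, rel_int P`_k) -> exists Q, poly_rel R P Q.
Proof.
have rP := poly_relP rR.
elim/poly_ind: P => [|P c IH] iP; first by exists 0; exact: (rel0 rP).
have [k|Q RPQ] := IH; first by have := iP k.+1; rewrite coefD coefMX coefC addr0.
have [d Rcd] : rel_int c by have := iP 0%N; rewrite coefD coefMX coefC add0r.
exists (Q * 'X + d%:P); apply: (relD rP); last exact: poly_relC.
by apply: (relM rP) => //; apply: poly_relX.
Qed.

Hypothesis R_fun : forall a b b', R a b -> R a b' -> b = b'.

(** Each side of the identity over [A] is related to its counterpart over [B]; as [R] is functional,
    equality carries over. *)
Lemma rel_reduction_step (r n : nat) (f h : {poly A}) (f' h' : {poly B})
    (N : 'M[A]_(r.-1)) (N' : 'M[B]_(r.-1)) (j : 'I_(r.-1)) :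
  poly_rel R f f' -> poly_rel R h h' -> (forall i j, R (N i j) (N' i j)) ->
  'X^(r - j.+1) * f - theta h * f + n%:R * (theta f * h)
    = \sum_(k < r.-1) (N k j)%:P * 'X^(r - k.+1) ->
  'X^(r - j.+1) * f' - theta h' * f' + n%:R * (theta f' * h')
    = \sum_(k < r.-1) (N' k j)%:P * 'X^(r - k.+1).
Proof.
move=> Rf Rh RN E; have rP := poly_relP rR.
have RX := poly_relX rR.
have Rtheta g g' : poly_rel R g g' -> poly_rel R (theta g) (theta g').
  by move=> Rg; apply: (relM rP RX); apply: poly_rel_deriv.
have RXn k : poly_rel R 'X^k 'X^k := rel_exp rP k RX.
have RL : poly_rel R ('X^(r - j.+1) * f - theta h * f + n%:R * (theta f * h))
    ('X^(r - j.+1) * f' - theta h' * f' + n%:R * (theta f' * h')).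
  apply: (relD rP); [apply: (relB rP)|].
  - exact: (relM rP (RXn _) Rf).
  - exact: (relM rP (Rtheta _ _ Rh) Rf).
  exact: (relM rP (rel_nat rP n) (relM rP (Rtheta _ _ Rf) Rh)).
have RR : poly_rel R (\sum_(k < r.-1) (N k j)%:P * 'X^(r - k.+1))
    (\sum_(k < r.-1) (N' k j)%:P * 'X^(r - k.+1)).
  apply: (rel_sum rP) => k _; exact: (relM rP (poly_relC rR (RN k j)) (RXn _)).
by apply/polyP => k; apply: R_fun (RL k) _; rewrite E; apply: RR.
Qed.

Lemma rel_mulmx m1 m2 m3 (M : 'M[A]_(m1, m2)) (N : 'M[A]_(m2, m3))
    (M' : 'M[B]_(m1, m2)) (N' : 'M[B]_(m2, m3)) :
  (forall i j, R (M i j) (M' i j)) -> (forall i j, R (N i j) (N' i j)) ->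
  forall i j, R ((M *m N) i j) ((M' *m N') i j).
Proof.
by move=> RM RN i j; rewrite !mxE; apply: rel_sum => // k _; apply: relM.
Qed.
End RelIntegral.

Lemma JbezoutE (A : idomainType) d (F G : {poly A}) (i j : 'I_d) :
  (Jmx A d *m bezout_mx d F G) i j = bez_coef F G (d.-1 - i) j.
Proof.
have id := ltn_ord i; have kd : (d.-1 - i < d)%N by lia.
rewrite mxE (bigD1 (Ordinal kd)) //= big1 => [|k nk].
  by rewrite addr0 mxE bezout_mxE /= subnKC ?eqxx ?mul1r //; lia.
rewrite mxE (_ : (_ == _) = false) ?mul0r //; apply/eqP => E.
by case/eqP: nk; apply/val_inj => /=; lia.
Qed.

(** Only [g 0 = 0] is assumed because the intended [g] is [redp], which is not additive on all
    rationals. *)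
Lemma mcoeff_map_mpoly0 n (R S : nzRingType) (g : R -> S) (a : {mpoly R[n]}) m :
  g 0 = 0 -> (map_mpoly g a)@_m = g a@_m.
Proof.
move=> g0; rewrite /map_mpoly /mmap raddf_sum /=.
under eq_bigr do rewrite mmap1_id mcoeffCM mcoeffX.
have [ma|na] := boolP (m \in msupp a).
  rewrite (bigD1_seq m) ?msupp_uniq //= eqxx mulr1 big1 ?addr0 // => m' nm.
  by rewrite (negPf nm) mulr0.
rewrite (memN_msupp_eq0 na) g0 big1_seq // => m' /andP[_ m'a].
by rewrite (_ : (_ == _) = false) ?mulr0 //; apply: contraNF na => /eqP <-.
Qed.

Section Integrality.
Variables (p r : nat).
Hypothesis p_pr : prime p.
Hypotheses (r_gt1 : (1 < r)%N) (r_lt_p : (r < p)%N).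
Local Notation A := {mpoly rat[r]}.

Definition pol_rel := mpoly_rel (@red_rel p) (n := r).
Local Notation pint_pol := (rel_int pol_rel).

Lemma pol_relP : ring_rel pol_rel.
Proof. exact (mpoly_relP (red_relP p_pr) r). Qed.

Lemma pol_rel_fun a b b' : pol_rel a b -> pol_rel a b' -> b = b'.
Proof.
move=> Rb Rb'; apply/mpolyP => m.
by have [_ <-] := red_rel_redp p_pr (Rb m); have [_ <-] := red_rel_redp p_pr (Rb' m).
Qed.

(** Any witness of integrality has the reduced coefficients, so it coincides with the concrete
    reduction [map_mpoly (redp p)]. *)
Lemma pint_pol_redp a : pint_pol a ->
  (forall m, pint p a@_m) /\ pol_rel a (map_mpoly (redp p) a).
Proof.
move=> [b Rb]; split=> [m|]; first by have [] := red_rel_redp p_pr (Rb m).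
suff -> : map_mpoly (redp p) a = b by [].
apply/mpolyP => m; rewrite mcoeff_map_mpoly0 ?/redp ?mul0r //.
by have [_] := red_rel_redp p_pr (Rb m).
Qed.

Lemma fpoly_rel : poly_rel pol_rel (fpoly rat r) (fpoly 'F_p r).
Proof.
have rP := poly_relP pol_relP; apply: (rel_prod rP) => i _.
apply: (relB rP); first exact: (poly_relX pol_relP).
apply: (poly_relC pol_relP); exact: (mpoly_relX (red_relP p_pr)).
Qed.

Lemma phi_rel : exists Q, poly_rel pol_rel (phi r) Q.
Proof.
apply: (rel_int_poly pol_relP) => k; rewrite coef_poly.
case: ifP => _; last exact: (rel_int0 pol_relP).
by exists (fpoly 'F_p r)`_(r - k); apply: fpoly_rel.
Qed.

Lemma pint_polC q : rel_int (@red_rel p) q -> pint_pol q%:MP.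
Proof. by move=> [x Rq]; exists x%:MP; apply: (mpoly_relC (red_relP p_pr)). Qed.

Lemma rel_int_natV k : (0 < k < p)%N -> rel_int (@red_rel p) (k%:R)^-1.
Proof.
move=> /andP[k0 kp]; exists (k%:R)^-1; apply: red_rel_natV => //.
by rewrite gtnNdvd.
Qed.

Lemma binr_int lam k : (k < p)%N -> rel_int (@red_rel p) lam ->
  rel_int (@red_rel p) (binr lam k).
Proof.
move=> kp [x Rx]; have rP := red_relP p_pr.
apply: (rel_intM rP).
  exists (\prod_(i < k) (x - i%:R)); apply: (rel_prod rP) => i _.
  by apply: (relB rP Rx); apply: (rel_nat rP).
by exists (k`!%:R)^-1; apply: red_rel_natV => //; apply: prime_ndvd_fact.
Qed.

Lemma exponent_int m : rel_int (@red_rel p) (- m%:R / r%:R).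
Proof.
have rP := red_relP p_pr; apply: (rel_intM rP).
  by apply: (rel_intN rP); apply: (rel_int_nat rP).
by apply: rel_int_natV; rewrite ltnW.
Qed.

(** Only binomials of order at most [z < p] occur, so their factorial denominators are prime to
    [p]. *)
Lemma beta_int lam z : (z < p%:Z)%R -> rel_int (@red_rel p) lam ->
  pint_pol (beta r lam z).
Proof.
move=> zp lam_int; rewrite /beta; case: ifP => z0; first exact: (rel_int0 pol_relP).
have [Q RQ] := phi_rel; have rP := poly_relP pol_relP.
apply: (rel_int_sum pol_relP) => k _; apply: (rel_intM pol_relP).
  by apply: pint_polC; apply: binr_int => //; have := ltn_ord k; lia.
exists ((Q - 1) ^+ k)`_`|z|%N.
exact: (rel_exp rP k (relB rP RQ (rel1 rP))).
Qed.

Lemma root_series_int m l : (l <= r)%N -> (0 < m)%N -> pint_pol (root_series r m)`_l.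
Proof.
move=> lr m0; rewrite coef_root_series //; apply: beta_int; first by lia.
exact: exponent_int.
Qed.

Definition natV (k : nat) : A := ((k%:R : rat)^-1)%:MP.

Lemma natV_int k : (0 < k < p)%N -> pint_pol (natV k).
Proof. by move=> kp; apply: pint_polC; apply: rel_int_natV. Qed.

Lemma natVK k : (0 < k)%N -> natV k * k%:R = 1.
Proof.
move=> k0; rewrite -(mpolyC_nat r rat k) -mpolyCM mulVf ?mpolyC1 //.
exact: natr_rat_neq0.
Qed.

Lemma polar_int m s : (0 < m)%N ->
  pint_pol (polar_part r (phi r) (root_series r m))`_s.
Proof.
move=> m0; rewrite coef_poly; case: ifP => [sr|_]; last exact: (rel_int0 pol_relP).
have [Q RQ] := phi_rel.
rewrite coefM; apply: (rel_int_sum pol_relP) => k _; apply: (rel_intM pol_relP).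
  by exists Q`_k.
by apply: root_series_int => //; have := ltn_ord k; lia.
Qed.

End Integrality.

(** * The matrices of the statement and their reduction *)

Section Matrices.
Variable r : nat.
Hypothesis r_gt1 : (1 < r)%N.
Local Notation V := (root_series r).

Lemma Bmx_eq : Bmx r r.-1 = B_mx r (fpoly rat r) (natV r).
Proof. by apply/matrixP => i j; rewrite /Bmx JbezoutE mxE. Qed.

Lemma Qmx_eq : Qmx r r.-1 = Q_mx r V.
Proof.
apply/matrixP => i j; have ir := ltn_ord i; rewrite !mxE (coef_root_series r_gt1); last by lia.
by congr (beta _ _ _); lia.
Qed.

Lemma Pmx_eq : Pmx r r.-1 = P_mx r V.
Proof.
apply/matrixP => i j; have ir := ltn_ord i; have jr := ltn_ord j.
rewrite !mxE (coef_root_series r_gt1); last by lia.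
by congr (beta _ (- _ / _) _); [rewrite natrB //|]; lia.
Qed.

Lemma Zmx_eq n : (0 < n)%N -> Zmx r r.-1 n = Z_mx r (natV r) n.
Proof.
move=> n0; apply/matrixP => i j; have ir := ltn_ord i; rewrite !mxE; case: ifP => // _.
rewrite /natV -mpolyC_nat -mpolyCM natrB ?natrM ?natrB //; first by lia.
by have := leq_pmulr r n0; lia.
Qed.

Lemma rat_reduction_step n (j : 'I_(r.-1)) : (0 < n)%N ->
  let h := primitive (phi r) V (natV r) n j in
  'X^(r - j.+1) * fpoly rat r - theta h * fpoly rat r + n%:R * (theta (fpoly rat r) * h)
  = \sum_(k < r.-1) ((Bmx r r.-1 *m Qmx r r.-1 *m Zmx r r.-1 n *m Pmx r r.-1) k j)%:P
      * 'X^(r - k.+1).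
Proof.
move=> n0; rewrite Bmx_eq Qmx_eq Zmx_eq // Pmx_eq.
apply: reduction_step => //.
- exact: natVK.
- by rewrite size_fpoly.
- exact: phi0.
- exact: coef_phi.
- by move=> i; apply: root_series_ode.
by move=> i; eexists; [reflexivity|apply: coef0_binpow].
Qed.

Variable p : nat.
Hypothesis p_pr : prime p.
Hypothesis r_lt_p : (r < p)%N.
Local Notation pint_pol := (rel_int (@pol_rel p r)).

Lemma Bmx_int i j : pint_pol (Bmx r r.-1 i j).
Proof.
have rP := pol_relP r p_pr; have rPP := poly_relP rP.
have Rf := @fpoly_rel p r p_pr; have Rf' := poly_rel_deriv rP Rf.
have [c Rc] : pint_pol (natV r r) by apply: natV_int => //; rewrite ltnW.
have RG := relB rPP Rf (relM rPP (poly_relC rP Rc) (relM rPP (poly_relX rP) Rf')).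
rewrite Bmx_eq mxE; apply: (rel_int_sum rP) => k _.
by eexists; apply: (relB rP); apply: (relM rP); [exact: Rf'|exact: RG|exact: Rf'|exact: RG].
Qed.

Lemma Qmx_int i j : pint_pol (Qmx r r.-1 i j).
Proof. by rewrite Qmx_eq mxE; apply: root_series_int => //; have := ltn_ord i; lia. Qed.

Lemma Pmx_int i j : pint_pol (Pmx r r.-1 i j).
Proof. by rewrite Pmx_eq mxE; apply: root_series_int => //; have := ltn_ord i; lia. Qed.

Variable n : nat.
Hypothesis n_gt0 : (0 < n)%N.
Hypothesis rn : (r * n < p)%N.

Lemma natV_zeta_int (i : 'I_(r.-1)) : pint_pol (natV r (r * n - (r - i.+1))).
Proof.
apply: natV_int => //; have := leq_pmulr r n_gt0; have := ltn_ord i; lia.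
Qed.

Lemma Zmx_int i j : pint_pol (Zmx r r.-1 n i j).
Proof.
have rP := pol_relP r p_pr; rewrite Zmx_eq // mxE; case: ifP => _.
  by apply: (rel_intM rP (rel_int_nat rP n)); apply: natV_zeta_int.
exact: (rel_int0 rP).
Qed.

Lemma primitive_int (j : 'I_(r.-1)) k :
  pint_pol (primitive (phi r) V (natV r) n j)`_k.
Proof.
have rP := pol_relP r p_pr; rewrite coefN coef_sum; apply: (rel_intN rP).
apply: (rel_int_sum rP) => i _; rewrite coefCM; apply: (rel_intM rP).
  by apply: (rel_intM rP (natV_zeta_int i)); rewrite -Pmx_eq; apply: Pmx_int.
exact: polar_int.
Qed.

(** The witness is the reduction of the rational [primitive]: every ingredient of the identity over
    the rationals is [p]-integral. *)
Lemma Fp_reduction_step (j : 'I_(r.-1)) : exists h : {poly {mpoly 'F_p[r]}},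
  'X^(r - j.+1) * fpoly 'F_p r - theta h * fpoly 'F_p r
     + n%:R * (theta (fpoly 'F_p r) * h)
  = \sum_(k < r.-1) ((redmx p (Bmx r r.-1) *m redmx p (Qmx r r.-1)
       *m redmx p (Zmx r r.-1 n) *m redmx p (Pmx r r.-1)) k j)%:P * 'X^(r - k.+1).
Proof.
have rP := pol_relP r p_pr.
have [h Rh] := rel_int_poly rP (primitive_int j).
exists h.
apply: (rel_reduction_step rP (pol_rel_fun p_pr) (@fpoly_rel p r p_pr) Rh) (rat_reduction_step j n_gt0).
have red (M : 'M[{mpoly rat[r]}]_(r.-1)) : (forall i j, pint_pol (M i j)) ->
    forall i j : 'I_(r.-1), pol_rel (M i j) (redmx p M i j).
  by move=> iM i k; rewrite mxE; have [_] := pint_pol_redp p_pr (iM i k).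
exact: (rel_mulmx rP (rel_mulmx rP (rel_mulmx rP (red _ Bmx_int) (red _ Qmx_int))
  (red _ Zmx_int)) (red _ Pmx_int)).
Qed.
End Matrices.

(** * Conclusion over the fraction field *)

Lemma invmx_tofracM (A : idomainType) d (M N : 'M[A]_d) :
  map_mx (@tofrac A) M \in unitmx ->
  invmx (map_mx (@tofrac A) M) *m map_mx (@tofrac A) (M *m N) = map_mx (@tofrac A) N.
Proof. by move=> uM; rewrite map_mxM mulKmx. Qed.

Theorem theorem5 (p r e d : nat) :
  prime p -> inB0 p r e d -> inB0 p r e.+1 d ->
  let n := (p.-1 - e)%N in
  [/\ [/\ mx_pint p (Bmx r d), mx_pint p (Qmx r d), mx_pint p (Zmx r d n)
         & mx_pint p (Pmx r d)],
      map_mx (@tofrac {mpoly 'F_p[r]}) (Mmx p d (fpoly 'F_p r ^+ e)) \in unitmx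
    & invmx (map_mx (@tofrac {mpoly 'F_p[r]}) (Mmx p d (fpoly 'F_p r ^+ e)))
        *m map_mx (@tofrac {mpoly 'F_p[r]}) (Mmx p d (fpoly 'F_p r ^+ e.+1))
      = map_mx (@tofrac {mpoly 'F_p[r]})
          (redmx p (Bmx r d) *m redmx p (Qmx r d) *m redmx p (Zmx r d n)
             *m redmx p (Pmx r d))].
Proof.
move=> p_pr [/andP[r_gt1 _] _ _ r_e ->] [_ _ e_p _ _] n.
have p_gt0 := prime_gt0 p_pr.
(* The second triple gives [e + 1 <= p - 1], hence [n > 0]; the first gives [r n < p]; together they
   force [r < p]. *)
have n_gt0 : (0 < n)%N by rewrite /n; lia.
have rn : (r * n < p)%N by rewrite -[p]prednK // ltnS.
have r_lt_p : (r < p)%N by apply: leq_ltn_trans rn; rewrite leq_pmulr.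
have pint_mx (M : 'M[{mpoly rat[r]}]_(r.-1)) : (forall i j, rel_int (@pol_rel p r) (M i j)) ->
    @mx_pint p r r.-1 M.
  by move=> iM i j m; have [] := pint_pol_redp p_pr (iM i j).
have M_unit : map_mx (@tofrac {mpoly 'F_p[r]}) (Mmx p r.-1 (fpoly 'F_p r ^+ e)) \in unitmx.
  rewrite unitmxE det_map_mx unitfE tofrac_eq0 det_Mmx_fpoly // ?r_gt1 //; lia.
split=> //.
  split; apply: pint_mx => i j; [exact: Bmx_int|exact: Qmx_int| |exact: Pmx_int].
  exact: Zmx_int.
rewrite (Mmx_exp_recurrence _ _ (Fp_reduction_step r_gt1 p_pr r_lt_p n_gt0 rn)).
- exact: invmx_tofracM.
- by rewrite -mpolyC_nat pchar_Fp_0.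
by rewrite /n; lia.
Qed.
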